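(* If a graph $G$ admits an empty-ply drawing, then every vertex of $G$ has degree at most $24$.
   Context: A straight-line drawing of a graph places each vertex at a distinct point of the plane and draws each edge as the straight-line segment between its endpoints. For each vertex $v$, the ply-disk $D_v$ is the open disk centered at $v$ with radius equal to half the length of the longest edge incident to $v$. A drawing is empty-ply if every ply-disk $D_v$ contains no vertex other than $v$ in its interior. *)

(* Defs.v *)
From HB Require Import structures.
From mathcomp Require Import all_boot all_order all_algebra.
From mathcomp Require Import classical_sets reals.

Set Implicit Arguments.
Unset Strict Implicit.
Unset Printing Implicit Defensive.

Import Order.TTheory GRing.Theory Num.Theory.
Local Open Scope ring_scope.

Record sgraph := SGraph {
  vertex :> finType;
  adj : rel vertex;
  adj_sym : symmetric adj;
  adj_irrefl : irreflexive adj
}.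

Definition degree (G : sgraph) (v : G) : nat := #|[pred w : G | adj v w]|.

(* The library norm on R * R is the sup norm, so the Euclidean distance is
   spelled out. *)
Definition edist (R : realType) (p q : R * R) : R :=
  Num.sqrt ((p.1 - q.1) ^+ 2 + (p.2 - q.2) ^+ 2).

Definition open_disk (R : realType) (c : R * R) (r : R) : set (R * R) :=
  fun p => edist c p < r.

(* A straight-line drawing is determined by the vertex positions: each edge vw
   is the segment [pos v, pos w]. Crossings are allowed. *)
Record drawing (R : realType) (G : sgraph) := Drawing {
  pos :> G -> R * R;
  pos_inj : injective pos
}.

(* Edge lengths are nonnegative, so the default 0 of the maximum only matters
   for an isolated vertex, whose ply-disk is then empty. *)
Definition longest_edge (R : realType) (G : sgraph) (d : drawing R G) (v : G) : R :=
  \big[Num.max/0]_(w : G | adj v w) edist (d v) (d w).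

Definition ply_disk (R : realType) (G : sgraph) (d : drawing R G) (v : G) :
    set (R * R) :=
  open_disk (d v) (longest_edge d v / 2).

Definition empty_ply (R : realType) (G : sgraph) (d : drawing R G) : Prop :=
  forall v w : G, w <> v -> ~ ply_disk d v (d w).

(* Main.v *)
(* Let L be the length of the longest edge at v. As the disk of v is empty, the
   neighbours of v lie at distances in [L/2, L]; as the disks of the neighbours
   are empty, two neighbours at distances r <= s are at least s/2 apart. Cut the
   annulus at radius L / sqrt 2. Within each half r/s is at least 1 / sqrt 2, and
   the law of cosines then bounds the cosine of the angle at v between two
   neighbours by 5 sqrt 2 / 8 < 221/250. This angle exceeds 2 pi / 13, hence each
   half contains at most 12 neighbours. *)

Require Import Defs.
From HB Require Import structures.
From mathcomp Require Import all_boot all_order all_algebra.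
From mathcomp Require Import classical_sets reals.
From mathcomp Require Import ring lra archimedean boolp trigo.

Set Implicit Arguments.
Unset Strict Implicit.
Unset Printing Implicit Defensive.

Import Order.TTheory GRing.Theory Num.Theory.
Local Open Scope ring_scope.

(** Chebyshev's three-term recurrence, used to step through the multiples of an angle. *)
Lemma cosD_cosB (R : realType) (x y : R) :
  cos (x + y) = 2 * cos y * cos x - cos (x - y).
Proof. by rewrite cosD cosB; ring. Qed.

Lemma acos_221_250_gt (R : realType) : 2 * pi < 13 * acos (221 / 250 : R).
Proof.
set a := acos _.
have [/andP[a0 api] ca] : 0 <= a <= pi /\ cos a = 221 / 250.
  by apply: acos_def; apply/andP; split; lra.
rewrite ltNge; apply/negP => le13.
have pi0 := pi_gt0 R.
pose b := a / 2.
have ab : a = b + b by rewrite /b; field.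
have cb0 : 0 <= cos b by apply: cos_ge0_pihalf; apply/andP; split; lra.
have cb2 : 2 * cos b ^+ 2 = 1 + 221 / 250.
  by rewrite -ca ab -mulr2n cos_mulr2n; ring.
(* A lower bound suffices: [cos (7 b)] turns out to be a negative multiple of [cos b]. *)
have cb : 97 / 100 <= cos b by nra.
have c2 : cos (a + a) = 2 * (221 / 250) ^+ 2 - 1.
  by rewrite -mulr2n cos_mulr2n ca; ring.
have c3 : cos (a + a + a) = 4 * (221 / 250) ^+ 3 - 3 * (221 / 250).
  by rewrite cosD_cosB addrK c2 ca; ring.
(* The odd multiples [3 b], [5 b], [7 b] follow by steps of [a = 2 b], starting from [- b] and
   [b]. *)
have d1 : cos (b + a) = (2 * (221 / 250) - 1) * cos b.
  rewrite cosD_cosB ca (_ : b - a = - b) ?cosN; first by ring.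
  by rewrite ab; ring.
have d2 : cos (b + a + a) = 2 * (221 / 250) * cos (b + a) - cos b.
  by rewrite cosD_cosB addrK ca.
have d3 : cos (b + a + a + a) = 2 * (221 / 250) * cos (b + a + a) - cos (b + a).
  by rewrite cosD_cosB addrK ca.
(* [6b <= pi - 7b], whereas [cos 6b < - cos 7b] numerically. *)
have : cos (a + a + a) < cos (pi - (b + a + a + a)).
  by rewrite cosB cospi sinpi c3 d3 d2 d1; lra.
rewrite ltr_cos ?in_itv/=; last first.
- by apply/andP; split; lra.
- by apply/andP; split; lra.
by rewrite ltNge => /negP; apply; lra.
Qed.

(** [acos x] serves the upper half circle, its reflection [2 pi - acos x] the lower one. *)
Lemma unit_vector_polar (R : realType) (x y : R) : x ^+ 2 + y ^+ 2 = 1 ->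
  exists t : R, [/\ 0 <= t, t <= 2 * pi, cos t = x & sin t = y].
Proof.
move=> xy1; have x1 : -1 <= x <= 1 by apply/andP; split; nra.
have [/andP[a0 api] ca] := acos_def x1.
have sa : sin (acos x) = `|y|.
  by rewrite sin_acos// -xy1 addrAC subrr add0r sqrtr_sqr.
have pi0 := pi_gt0 R.
have [y0|y0] := leP 0 y.
  by exists (acos x); split; rewrite ?sa ?ger0_norm//; lra.
exists (- acos x + pi *+ 2); split; [lra|lra| |].
  by rewrite cosD2pi cosN.
by rewrite sinD2pi sinN sa ltr0_norm// opprK.
Qed.

(** Cosine strictly decreases on [[0, pi]]; the upper bound is the lower one for [2 pi - t], which
    has the same cosine. *)
Lemma cos_le_dist (R : realType) (a t : R) : 0 <= a -> a <= pi ->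
  0 <= t -> t <= 2 * pi -> cos t <= cos a -> a <= t <= 2 * pi - a.
Proof.
move=> a0 api t0 t2pi; rewrite leNgt => /negP cta.
apply/andP; split; rewrite leNgt; apply/negP => lt_t; apply: cta.
  by rewrite ltr_cos ?in_itv/=; [|apply/andP; split..]; lra.
rewrite -(cosN t) -(cosD2pi (- t)).
by rewrite ltr_cos ?in_itv/= ?mulr2n; [|apply/andP; split..]; lra.
Qed.

(* One direction is taken as the origin of angles; the other ones lie in an arc
   of length [2 pi - 2 a], where [a] is the minimal angle, and [2 pi < 13 a]
   cuts this arc into 11 half-open pieces of length at most [a]. *)
Lemma card_separated_directions (R : realType) (T : finType) (A : {set T})
    (x y r : T -> R) :
  {in A, forall i, 0 < r i} -> (forall i, x i ^+ 2 + y i ^+ 2 = r i ^+ 2) ->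
  {in A &, forall i j, i != j ->
     x i * x j + y i * y j <= 221 / 250 * (r i * r j)} ->
  (#|A| <= 12)%N.
Proof.
move=> r0 xyr sep.
have [->|[o oA]] := set_0Vmem A; first by rewrite cards0.
have := acos_221_250_gt R; set a := acos _ => a13.
have [/andP[a0 api] ca] : 0 <= a <= pi /\ cos a = 221 / 250.
  by apply: acos_def; apply/andP; split; lra.
have pi0 := pi_gt0 R; have {}a0 : 0 < a by lra.
(* Dot and cross product with [o] give the angle from [o] to [i]. Membership sits under the
   existential so that choice yields a total [t]. *)
have polar i : exists t : R, i \in A ->
    [/\ 0 <= t, t <= 2 * pi, cos t * (r o * r i) = x o * x i + y o * y i
      & sin t * (r o * r i) = x o * y i - y o * x i].
  have [iA|] := boolP (i \in A); last by exists 0.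
  have ro := r0 _ oA; have ri := r0 _ iA.
  have rori : r o * r i != 0 by rewrite mulf_neq0// gt_eqF.
  have [|t [t0 t2pi ct st]] := @unit_vector_polar _
    ((x o * x i + y o * y i) / (r o * r i)) ((x o * y i - y o * x i) / (r o * r i)).
    rewrite !expr_div_n -mulrDl.
    apply: (mulIf (expf_neq0 2 rori)).
    by rewrite mulfVK ?expf_neq0// mul1r exprMn -(xyr o) -(xyr i); ring.
  by exists t => _; split; rewrite // ?ct ?st mulfVK.
have [t tP] := choice polar.
have tbnd i : i \in A :\ o -> a <= t i <= 2 * pi - a.
  rewrite in_setD1 => /andP[io iA]; have [t0 t2pi ct _] := tP _ iA.
  apply: cos_le_dist => //; first exact: ltW.
  have rr : 0 < r o * r i by rewrite mulr_gt0 ?r0.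
  by rewrite ca -(ler_pM2r rr) ct sep// eq_sym.
have f0 i : i \in A :\ o -> 0 <= (t i - a) / a.
  by move=> /tbnd /andP[? _]; rewrite divr_ge0 ?subr_ge0// ltW.
(* The default of [inord] is never reached on [A :\ o]: there the quotient is at most
   [(2 pi - 2 a) / a < 11]. *)
pose f i : 'I_11 := inord (Num.truncn ((t i - a) / a)).
have fE i : i \in A :\ o -> f i = Num.truncn ((t i - a) / a) :> nat.
  move=> iA; rewrite inordK// truncn_lt_nat ?f0// ltr_pdivrMr//.
  by have /andP[_ ?] := tbnd _ iA; lra.
have f_inj : {in A :\ o &, injective f}.
  move=> i j iA jA /(congr1 val)/=; rewrite !fE// => fij.
  apply/eqP/negP => /negP ij.
  have /andP[] := truncn_itv (f0 _ iA); have /andP[] := truncn_itv (f0 _ jA).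
  rewrite -fij; set n := Num.truncn _.
  rewrite !ler_pdivlMr// !ltr_pdivrMr// -natr1 => j1 j2 i1 i2.
  move: iA jA; rewrite !in_setD1 => /andP[_ iA] /andP[_ jA].
  have [_ _ ci si] := tP _ iA; have [_ _ cj sj] := tP _ jA.
  have := sep _ _ iA jA ij; apply/negP; rewrite -ltNge -ca.
  have ro := r0 _ oA; have ri := r0 _ iA; have rj := r0 _ jA.
  (* Expanding both vectors in the orthogonal frame of [o] and its quarter turn gives [r o ^+ 2]
     times the dot product. *)
  have -> : x i * x j + y i * y j = cos (t i - t j) * (r i * r j).
    apply: (mulfI (x := r o ^+ 2)); first by rewrite expf_neq0// gt_eqF.
    transitivity ((cos (t i) * (r o * r i)) * (cos (t j) * (r o * r j)) +
                  (sin (t i) * (r o * r i)) * (sin (t j) * (r o * r j))).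
      by rewrite ci cj si sj -xyr; ring.
    by rewrite cosB; ring.
  rewrite ltr_pM2r ?mulr_gt0// -(cos_norm (t i - t j)).
  have dij : `|t i - t j| < a by rewrite ltr_norml; apply/andP; split; lra.
  have d0 := normr_ge0 (t i - t j).
  by rewrite ltr_cos// in_itv/=; apply/andP; split; lra.
rewrite (cardsD1 o) oA -(card_in_imset f_inj).
by rewrite (leq_ltn_trans (max_card _))// card_ord.
Qed.

(* With [u = r / s], the bound is [(u + 3 / (4 u)) / 2 <= 221 / 250]; the left
   side is convex in [u] and at most [5 sqrt 2 / 8] on [[1 / sqrt 2, 1]]. *)
Lemma dot_le_of_far (R : realType) (r s x y x' y' : R) :
  0 < r -> r <= s -> s ^+ 2 <= 2 * r ^+ 2 ->
  x ^+ 2 + y ^+ 2 = r ^+ 2 -> x' ^+ 2 + y' ^+ 2 = s ^+ 2 ->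
  s ^+ 2 / 4 <= (x - x') ^+ 2 + (y - y') ^+ 2 ->
  x * x' + y * y' <= 221 / 250 * (r * s).
Proof.
move=> r0 rs sr xyr xys far.
(* [707 / 1000] is just below [1 / sqrt 2]. *)
have s_le : s * (707 / 1000) <= r by nra.
(* Convexity as a chord bound: [r ^+ 2] is at most [1.707 r s - 0.707 s ^+ 2]. *)
have : (r - 707 / 1000 * s) * (s - r) >= 0 by rewrite mulr_ge0 ?subr_ge0//; lra.
nra.
Qed.

Lemma edist_ge0 (R : realType) (p q : R * R) : 0 <= edist p q.
Proof. exact: sqrtr_ge0. Qed.

Lemma edist_sqr (R : realType) (p q : R * R) :
  edist p q ^+ 2 = (p.1 - q.1) ^+ 2 + (p.2 - q.2) ^+ 2.
Proof. by rewrite sqr_sqrtr// addr_ge0 ?sqr_ge0. Qed.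

Lemma edist_gt0 (R : realType) (p q : R * R) : p <> q -> 0 < edist p q.
Proof.
move=> pq; rewrite lt_def edist_ge0 andbT; apply/eqP => d0; apply: pq.
move: (edist_sqr p q); rewrite d0 expr0n/= => /esym/eqP.
rewrite paddr_eq0 ?sqr_ge0// !sqrf_eq0 !subr_eq0 => /andP[/eqP p1 /eqP p2].
by rewrite [p]surjective_pairing p1 p2 -surjective_pairing.
Qed.

Lemma edistC (R : realType) (p q : R * R) : edist p q = edist q p.
Proof. by rewrite /edist -(opprB q.1) -(opprB q.2) !sqrrN. Qed.

Lemma edge_le_longest_edge (R : realType) (G : sgraph) (d : drawing R G)
    (v w : G) : adj v w -> edist (d v) (d w) <= longest_edge d v.
Proof. by move=> vw; exact: le_bigmax_cond. Qed.

Lemma empty_ply_dist (R : realType) (G : sgraph) (d : drawing R G) (v w : G) :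
  empty_ply d -> w != v -> longest_edge d v / 2 <= edist (d v) (d w).
Proof. by move=> ed /eqP wv; rewrite leNgt; apply/negP/ed. Qed.

Lemma card_neighbours_ratio (R : realType) (G : sgraph) (d : drawing R G)
    (v : G) (A : {set G}) :
  empty_ply d -> {in A, forall w, adj v w} ->
  {in A &, forall w w', edist (d v) (d w') ^+ 2 <= 2 * edist (d v) (d w) ^+ 2} ->
  (#|A| <= 12)%N.
Proof.
move=> ed Av ratio; pose r w := edist (d v) (d w).
have r0 : {in A, forall w, 0 < r w}.
  move=> w /Av vw; apply: edist_gt0 => /pos_inj vE.
  by move: vw; rewrite -vE adj_irrefl.
apply: (@card_separated_directions _ _ _ (fun w => (d v).1 - (d w).1)
  (fun w => (d v).2 - (d w).2) r) => // [w|]; first by rewrite edist_sqr.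
have main : {in A &, forall w w', w != w' -> r w <= r w' ->
    ((d v).1 - (d w).1) * ((d v).1 - (d w').1) +
    ((d v).2 - (d w).2) * ((d v).2 - (d w').2) <= 221 / 250 * (r w * r w')}.
  move=> w w' wA w'A ww' le_r.
  apply: dot_le_of_far; rewrite ?r0 -?edist_sqr ?ratio//.
  (* The edge back to [v] makes the ply-disk of the farther neighbour [w'] have radius at least
     [r w' / 2]. *)
  have w'v : adj w' v by rewrite adj_sym Av.
  have := edge_le_longest_edge d w'v; have := empty_ply_dist ed ww'.
  rewrite (edistC (d w')) (edistC _ (d v)) -/(r w') => far le_r'.
  have {le_r'}far : r w' / 2 <= edist (d w) (d w') by lra.
  have r'0 := r0 _ w'A.
  have : (r w' / 2) ^+ 2 <= edist (d w) (d w') ^+ 2.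
    by rewrite ler_pXn2r// ?nnegrE; lra.
  by rewrite edist_sqr; lra.
move=> w w' wA w'A ww'; have [le_r|/ltW le_r] := leP (r w) (r w').
  exact: main.
have := main _ _ w'A wA _ le_r; rewrite eq_sym => /(_ ww').
by rewrite (mulrC (r w')) ![_ * ((d v).1 - (d w).1)]mulrC
  ![_ * ((d v).2 - (d w).2)]mulrC.
Qed.

Theorem theorem3 (R : realType) (G : sgraph) :
  (exists d : drawing R G, empty_ply d) ->
  forall v : G, (degree v <= 24)%N.
Proof.
move=> [d ed] v.
pose L := longest_edge d v; pose r w := edist (d v) (d w).
have rL w : adj v w -> L / 2 <= r w /\ r w <= L.
  move=> vw; split; last exact: edge_le_longest_edge.
  apply: empty_ply_dist => //.
  by apply: contraTN vw => /eqP ->; rewrite adj_irrefl.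
have r2L w : adj v w -> L ^+ 2 <= 4 * r w ^+ 2 /\ r w ^+ 2 <= L ^+ 2.
  by move=> /rL[? ?]; have : 0 <= r w := edist_ge0 _ _; split; nra.
pose A := [set w | adj v w].
(* The cut at [L / sqrt 2], squared. Squared distances lie in [[L ^+ 2 / 4, L ^+ 2 / 2]] inside [B]
   and in [[L ^+ 2 / 2, L ^+ 2]] outside, so they differ by a factor of at most 2 in each half. *)
pose B := [set w : G | 2 * r w ^+ 2 <= L ^+ 2].
rewrite /degree -cardsE -/A -(cardsID B A) (@leq_add _ _ 12 12)//.
  apply: (@card_neighbours_ratio _ _ d v) => [//|w|w w']; rewrite !inE.
    by case/andP.
  move=> /andP[/r2L[? ?] ?] /andP[/r2L[? ?] ?]; by rewrite -/(r w) -/(r w'); lra.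
apply: (@card_neighbours_ratio _ _ d v) => [//|w|w w']; rewrite !inE.
  by case/andP.
rewrite -!ltNge => /andP[? /r2L[? ?]] /andP[? /r2L[? ?]].
by rewrite -/(r w) -/(r w'); lra.
Qed.
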